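(* Let $t,d \ge 1$ (possibly depending on $n$) with $td^2 \in o(n/\log n)$. Then $$\log|\mathcal{G}_{t,d}| \;\ge\; (2dt-1)\, n \log n - \big[4n \log d + 2n \log t + 2n \log\log n + n\big]\,dt - 2n - O(\log n).$$
   Context: All logarithms are base 2. A graph $G$ on $n$ vertices has a $d$-dimensional $t$-representation if each vertex $v$ can be assigned a set of at most $t$ pairwise disjoint $d$-dimensional axis-parallel boxes (each box a product $[l_1,r_1]\times\cdots\times[l_d,r_d]$ of closed real intervals) such that two distinct vertices $u,v$ are adjacent if and only if some box assigned to $u$ intersects some box assigned to $v$. $\mathcal{G}_{t,d}$ denotes the class of unlabeled (i.e., up to isomorphism) $n$-vertex graphs that have a $d$-dimensional $t$-representation, and $|\mathcal{G}_{t,d}|$ its cardinality. *)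

(* Defs.v *)
From mathcomp Require Import all_boot all_fingroup.
From Stdlib Require Import Reals ClassicalDescription.
From Stdlib Require List.

Set Implicit Arguments.
Unset Strict Implicit.
Unset Printing Implicit Defensive.

Definition log2 (x : R) : R := (ln x / ln 2)%R.

Definition graph (n : nat) := {set 'I_n * 'I_n}.

Definition simple_graph n (E : graph n) : bool :=
  [forall u, [forall v, ((u, v) \in E) == ((v, u) \in E)]] &&
  [forall u, (u, u) \notin E].

Record box (d : nat) := Box { lo : 'I_d -> R ; hi : 'I_d -> R }.

Definition box_valid d (b : box d) : Prop := forall i, (lo b i <= hi b i)%R.

Definition boxes_meet d (b c : box d) : Prop :=
  forall i, (lo b i <= hi c i)%R /\ (lo c i <= hi b i)%R.

Definition has_representation n (t d : nat) (E : graph n) : Prop :=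
  exists B : 'I_n -> list (box d),
    (forall v, (List.length (B v) <= t)%coq_nat) /\
    (forall v b, List.In b (B v) -> box_valid b) /\
    (forall v i j, (i < List.length (B v))%coq_nat -> (j < List.length (B v))%coq_nat ->
        i <> j -> ~ boxes_meet (List.nth i (B v) (Box (fun _ => 0%R) (fun _ => 0%R)))
                               (List.nth j (B v) (Box (fun _ => 0%R) (fun _ => 0%R)))) /\
    (forall u v, u <> v ->
        ((u, v) \in E <-> exists b c, List.In b (B u) /\ List.In c (B v) /\ boxes_meet b c)).

Definition has_representationb n t d (E : graph n) : bool :=
  if excluded_middle_informative (has_representation t d E) then true else false.

Definition isomorphic n (E F : graph n) : bool :=
  [exists p : {perm 'I_n}, [forall u, [forall v, ((u, v) \in E) == ((p u, p v) \in F)]]].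

(* the class G_{t,d} of unlabeled n-vertex graphs: isomorphism classes of
   representable simple graphs on 'I_n *)
Definition G_class (n t d : nat) : {set {set graph n}} :=
  [set [set F | isomorphic E F] | E in [set E : graph n | simple_graph E && has_representationb t d E]].

Definition card_G (n t d : nat) : nat := #|G_class n t d|.

(* Main.v *)
(** Reserve d * m vertices as markers: m parallel thin slabs orthogonal to each of
    the d axes. For each of the remaining n - d m vertices and each axis, choose 2t
    of the m + 1 gaps between consecutive slabs; paired in increasing order they are
    the endpoints, on that axis, of the t boxes of the vertex. Such a vertex meets
    slab x iff the number of chosen gaps up to x is odd, so the labeled graph
    determines all choices, and

      C(m+1, 2t)^(d (n - d m)) <= |G_{t,d}| * n!.

    Taking m close to sqrt 2 * n / (d log n) balances the choices lost on the marker
    vertices against the smaller number of gaps; Stirling's formula for n! and (2t)!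
    then gives the bound. *)

Require Import Defs.
From Stdlib Require Import Lra ClassicalDescription.
From Stdlib Require List.
From Coquelicot Require Import Coquelicot.
From mathcomp Require Import all_boot all_fingroup.
From Stdlib Require Import Reals.

Set Implicit Arguments.
Unset Strict Implicit.
Unset Printing Implicit Defensive.

Local Open Scope nat_scope.

(** * Passing from labeled graphs to isomorphism classes *)

Lemma isomorphic_refl n (E : graph n) : isomorphic E E.
Proof.
by apply/existsP; exists 1%g; apply/forallP=> u; apply/forallP=> v; rewrite !perm1.
Qed.

Lemma card_isomorphic n (E : graph n) : #|[set F | isomorphic E F]| <= n`!.
Proof.
pose relabel (p : {perm 'I_n}) : graph n :=
  [set w | ((p^-1)%g w.1, (p^-1)%g w.2) \in E].
have sub : [set F | isomorphic E F] \subset relabel @: setT.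
  apply/subsetP=> F; rewrite inE => /existsP[p /forallP Hp].
  apply/imsetP; exists p => //; apply/setP=> -[u v]; rewrite inE /=.
  by have /forallP/(_ ((p^-1)%g v))/eqP := Hp ((p^-1)%g u); rewrite !permKV.
apply: leq_trans (subset_leq_card sub) _.
by apply: leq_trans (leq_imset_card _ _) _; rewrite cardsT card_Sn.
Qed.

(** This is where the factor n! enters: split [X] into fibers of the map to isomorphism classes.
    Each fiber lies in a single class, hence has at most n! elements. *)
Lemma leq_card_G n t d (X : {set graph n}) :
  (forall E, E \in X -> simple_graph E /\ has_representation t d E) ->
  #|X| <= card_G n t d * n`!.
Proof.
move=> HX; pose cls (E : graph n) := [set F | isomorphic E F].
have sub : cls @: X \subset G_class n t d.
  apply: imsetS; apply/subsetP=> E /HX[sE rE]; rewrite inE sE /=.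
  by rewrite /has_representationb; case: excluded_middle_informative.
apply: leq_trans (_ : #|cls @: X| * n`! <= _); last first.
  by rewrite leq_mul2r subset_leq_card ?orbT.
rewrite -sum1_card (partition_big_imset cls) /= -sum_nat_const.
apply: leq_sum => _ /imsetP[E0 _ ->]; rewrite sum1dep_card.
apply: leq_trans (card_isomorphic E0); apply: subset_leq_card.
apply/subsetP=> E; rewrite inE => /andP[_ /eqP eqE].
by rewrite -/(cls E0) -eqE inE isomorphic_refl.
Qed.

(** * Intersection graphs of box assignments *)

Definition touch d (s1 s2 : list (box d)) : Prop :=
  exists b c, List.In b s1 /\ List.In c s2 /\ boxes_meet b c.

Definition meet_graph n d (B : 'I_n -> list (box d)) : graph n :=
  [set p | (p.1 != p.2) &&
     (if excluded_middle_informative (touch (B p.1) (B p.2)) then true else false)].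

Lemma meet_graphP n d (B : 'I_n -> list (box d)) u v : u != v ->
  (u, v) \in meet_graph B <-> touch (B u) (B v).
Proof.
by move=> uv; rewrite inE /= uv /=; case: excluded_middle_informative.
Qed.

Lemma touch_sym d (s1 s2 : list (box d)) : touch s1 s2 -> touch s2 s1.
Proof.
move=> [b [c [Hb [Hc bc]]]]; exists c, b; split => //; split => // i.
by have [] := bc i.
Qed.

Lemma meet_graph_simple n d (B : 'I_n -> list (box d)) : simple_graph (meet_graph B).
Proof.
apply/andP; split; last by apply/forallP=> u; rewrite inE eqxx.
apply/forallP=> u; apply/forallP=> v.
have [->|uv] := eqVneq u v; first by [].
have vu : v != u by rewrite eq_sym.
apply/eqP; apply/idP/idP=> [/(meet_graphP B uv)|/(meet_graphP B vu)] /touch_sym h.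
  exact/(meet_graphP B vu).
exact/(meet_graphP B uv).
Qed.

(** * Endpoint sets on one axis and the parity of their counting function *)

Definition ends m (S : {set 'I_m}) : seq nat := [seq val i | i <- enum S].

Lemma ends_sorted m (S : {set 'I_m}) : sorted ltn (ends S).
Proof.
rewrite /ends sorted_map /enum_mem.
apply: sorted_filter; first by move=> y x z /=; exact: ltn_trans.
by rewrite -enumT -sorted_map val_enum_ord iota_ltn_sorted.
Qed.

Lemma size_ends m (S : {set 'I_m}) : size (ends S) = #|S|.
Proof. by rewrite size_map cardE. Qed.

Lemma mem_ends m (S : {set 'I_m}) (x : 'I_m) : (val x \in ends S) = (x \in S).
Proof. by rewrite mem_map ?mem_enum //; exact: val_inj. Qed.

Definition rank (s : seq nat) (x : nat) : nat := count (fun y => y <= x) s.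

(** In a strictly increasing sequence the entries at most [x] form an initial segment, of length
    [rank s x]. *)
Lemma nth_leq_rank (s : seq nat) x i : sorted ltn s -> i < size s ->
  (nth 0 s i <= x) = (i < rank s x).
Proof.
rewrite /rank; elim: s i => [|a s IH] i //= Hp.
have [Ha Hs] : all (ltn a) s /\ sorted ltn s.
  by move: Hp; rewrite path_sortedE; [move/andP | exact: ltn_trans].
have none : x < a -> count (fun y => y <= x) s = 0.
  move=> xa; apply/eqP; rewrite -leqn0 leqNgt -has_count; apply/hasPn=> y ys.
  by rewrite -ltnNge (ltn_trans xa) //; exact: (allP Ha).
case: i => [_|i] /=.
  by case: (leqP a x) => // /none ->.
rewrite ltnS => Hi; rewrite IH //.
by case: (leqP a x) => // /none ->; rewrite ltn0.
Qed.

(** Crossing an endpoint alternately enters and leaves one of the t intervals, so [x] is inside one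
    exactly when it has passed an odd number of endpoints; half the rank, rounded down, is the index
    of that interval. *)
Lemma rank_odd (s : seq nat) t x : sorted ltn s -> size s = t.*2 ->
  reflect (exists2 j, j < t & nth 0 s j.*2 <= x < nth 0 s j.*2.+1)
          (odd (rank s x)).
Proof.
move=> Hs sz.
have cle : rank s x <= t.*2 by rewrite -sz count_size.
apply: (iffP idP) => [Ho | [j jt]].
  have e := odd_double_half (rank s x); rewrite Ho /= in e.
  have jt : (rank s x)./2 < t by rewrite -ltn_double -add1n e.
  exists (rank s x)./2; rewrite // ltnNge !nth_leq_rank ?sz //.
  - by rewrite -[X in _ < X]e add1n ltnSn /= -[X in _ < X]e add1n ltnn.
  - by rewrite ltn_Sdouble.
  - by rewrite ltn_double.
rewrite ltnNge !nth_leq_rank ?sz ?ltn_double ?ltn_Sdouble //.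
rewrite -leqNgt => Hr; suff -> : rank s x = j.*2.+1 by rewrite /= odd_double.
by apply/eqP; rewrite eqn_leq andbC.
Qed.

Lemma rankS (s : seq nat) x : uniq s -> rank s x.+1 = rank s x + (x.+1 \in s).
Proof.
rewrite /rank => us; rewrite -count_uniq_mem //; elim: s {us} => //= a s ->.
rewrite addnACA; congr (_ + _); rewrite leq_eqVlt ltnS.
by case: eqP => [->|_]; rewrite ?ltnn ?addn0.
Qed.

Lemma rank0 (s : seq nat) : uniq s -> rank s 0 = (0 \in s).
Proof.
rewrite /rank => us; rewrite -count_uniq_mem //; apply: eq_count => y.
by rewrite leqn0 eq_sym.
Qed.

(** Membership of x+1 is the change of parity from x to x+1. Only m markers separate the m+1 gaps,
    so the parity at m is not observed; there the rank is the cardinality, whose parity is given. *)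
Lemma rank_parity_inj m (S T : {set 'I_m.+1}) :
  odd #|S| = odd #|T| ->
  (forall x, x < m -> odd (rank (ends S) x) = odd (rank (ends T) x)) -> S = T.
Proof.
move=> eqm eqx.
have full (U : {set 'I_m.+1}) : rank (ends U) m = #|U|.
  rewrite -size_ends; apply/eqP; rewrite -all_count; apply/allP=> _ /mapP[y _ ->].
  exact: (ltn_ord y).
have eqx' x : x <= m -> odd (rank (ends S) x) = odd (rank (ends T) x).
  by rewrite leq_eqVlt => /predU1P[->|/eqx //]; rewrite !full.
have un (U : {set 'I_m.+1}) : uniq (ends U).
  by rewrite map_inj_uniq ?enum_uniq //; exact: val_inj.
apply/setP=> x; rewrite -!mem_ends; case: x => -[|x] /= xm.
  by have := eqx' 0 isT; rewrite !rank0 // !oddb.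
have := eqx' x.+1 xm; rewrite !rankS // !oddD (eqx' x (ltnW xm)) !oddb.
exact: addbI.
Qed.

Lemma INR_leP a b : reflect (INR a <= INR b)%R (a <= b).
Proof. by apply: (iffP idP) => [/leP/le_INR|/INR_le/leP]. Qed.

(** * The construction: d * m markers and k free vertices *)

Section Construction.
Variables (t d m k : nat).
Hypothesis d_gt0 : 0 < d.
Implicit Types (S : 'I_d -> {set 'I_m.+1}) (f : {ffun 'I_k * 'I_d -> {set 'I_m.+1}}).

(* Gap s sits at coordinate 2s and marker x at 2x+1, so that marker x lies
   between the gaps x and x+1. *)
Definition gap_box S (j : nat) : box d :=
  Box (fun i => INR (nth 0 (ends (S i)) j.*2).*2)
      (fun i => INR (nth 0 (ends (S i)) j.*2.+1).*2).

(** The slab is degenerate on its own axis and spans [0, 2m] on every other axis, the full range of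
    the gap coordinates. Comparing axes as naturals lets the quotient a / m serve directly as an
    axis. *)
Definition marker_box (i0 x : nat) : box d :=
  Box (fun i : 'I_d => INR (if i == i0 :> nat then x.*2.+1 else 0))
      (fun i : 'I_d => INR (if i == i0 :> nat then x.*2.+1 else m.*2)).

Definition free_boxes S : list (box d) := List.map (gap_box S) (List.seq 0 t).

Definition boxes_of f (v : 'I_(d * m + k)) : list (box d) :=
  match fintype.split v with
  | inl a => [:: marker_box (a %/ m) (a %% m)]
  | inr b => free_boxes (fun i => f (b, i))
  end.

Lemma In_free_boxes S b :
  List.In b (free_boxes S) <-> exists2 j, j < t & b = gap_box S j.
Proof.
rewrite List.in_map_iff; split=> [[j [<- /List.in_seq[_ /ltP jt]]]|[j jt ->]].
  by exists j.
by exists j; split => //; apply/List.in_seq; split; [exact/leP | exact/ltP].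
Qed.

Hypothesis t_gt0 : 0 < t.

Section Free.
Variable S : 'I_d -> {set 'I_m.+1}.
Hypothesis cardS : forall i, #|S i| = t.*2.

Let sizeS i : size (ends (S i)) = t.*2.
Proof. by rewrite size_ends. Qed.

Lemma ends_mono i a b : a < b -> b < t.*2 ->
  nth 0 (ends (S i)) a < nth 0 (ends (S i)) b.
Proof.
move=> ab bt; apply: (sorted_ltn_nth ltn_trans) => //; rewrite ?ends_sorted //.
all: by rewrite inE sizeS ?(ltn_trans ab bt).
Qed.

Lemma ends_bound i a : nth 0 (ends (S i)) a <= m.
Proof.
have [lt|ge] := ltnP a (size (ends (S i))); last by rewrite nth_default.
by have /mapP[y _ ->] := mem_nth 0 lt; exact: (ltn_ord y).
Qed.

Lemma gap_box_valid j : j < t -> box_valid (gap_box S j).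
Proof.
move=> jt i; apply/INR_leP; rewrite leq_double ltnW // ends_mono //.
by rewrite ltn_Sdouble.
Qed.

(** Axis 0 alone separates the boxes: there box j ends strictly before box l begins. *)
Lemma gap_box_disjoint j l : j < l -> l < t -> ~ boxes_meet (gap_box S j) (gap_box S l).
Proof.
move=> jl lt /(_ (Ordinal d_gt0)) [_ /INR_leP]; rewrite leq_double leqNgt ends_mono //.
  by rewrite ltn_Sdouble.
by rewrite ltn_double.
Qed.

(** On axis [i], parity makes the closed inequalities sharp: 2s <= 2x+1 means s <= x, and 2x+1 <= 2s
    means x < s. The other axes impose nothing, by [ends_bound]. *)
Lemma marker_meetP (i : 'I_d) x j : j < t ->
  boxes_meet (marker_box i x) (gap_box S j) <->
  nth 0 (ends (S i)) j.*2 <= x < nth 0 (ends (S i)) j.*2.+1.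
Proof.
move=> jt; split.
  move=> /(_ i) [] /=; rewrite eqxx => /INR_leP h1 /INR_leP h2.
  by rewrite -leq_Sdouble h2 -ltn_double h1.
move=> /andP[h1 h2] i'; split; apply/INR_leP.
  by case: eqP => // /val_inj ->; rewrite ltn_double.
case: eqP => [/val_inj ->|_]; first by rewrite leq_Sdouble.
by rewrite leq_double ends_bound.
Qed.

Lemma marker_touchP (i : 'I_d) x :
  touch [:: marker_box i x] (free_boxes S) <-> odd (rank (ends (S i)) x).
Proof.
split=> [[b [c [[<-|[]] [/In_free_boxes[j jt ->]]]]]|].
  by move/(marker_meetP _ _ jt) => h; apply/(rank_odd _ (ends_sorted _) (sizeS i)); exists j.
move/(rank_odd _ (ends_sorted _) (sizeS i)) => [j jt h].
exists (marker_box i x), (gap_box S j); split; first by left.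
by split; [apply/In_free_boxes; exists j | apply/marker_meetP].
Qed.

End Free.

Definition endpoint_choices : {set {ffun 'I_k * 'I_d -> {set 'I_m.+1}}} :=
  [set f | f \in ffun_on [set A : {set 'I_m.+1} | #|A| == t.*2]].

Lemma endpoint_choicesP f : f \in endpoint_choices -> forall p, #|f p| = t.*2.
Proof. by rewrite inE => /ffun_onP H p; have := H p; rewrite inE => /eqP. Qed.

Lemma card_endpoint_choices : #|endpoint_choices| = expn 'C(m.+1, t.*2) (k * d).
Proof. by rewrite cardsE card_ffun_on card_draws card_prod !card_ord. Qed.

Lemma meet_graph_representable f : f \in endpoint_choices ->
  has_representation t d (meet_graph (boxes_of f)).
Proof.
move=> /endpoint_choicesP cf; exists (boxes_of f); split; [|split; [|split]].
- move=> v; apply/leP; rewrite /boxes_of; case: fintype.split => [a|b] //=.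
  by rewrite List.length_map List.length_seq.
- move=> v b; rewrite /boxes_of; case: fintype.split => [a|c].
    case=> [<-|//] i /=; apply/INR_leP; by case: eqP.
  by case/In_free_boxes=> j jt ->; apply: gap_box_valid.
- move=> v i j; rewrite /boxes_of; case: fintype.split => [a|c].
    by move=> /ltP /= + /ltP /=; rewrite !ltnS !leqn0 => /eqP-> /eqP->.
  rewrite List.length_map List.length_seq => /ltP it /ltP jt nij.
  (* The default box in [has_representation] is not of the form [gap_box]; it is exchanged for one
     so that [List.map_nth] applies. *)
  have nthE l dflt : l < t ->
      List.nth l (free_boxes (fun i => f (c, i))) dflt = gap_box (fun i => f (c, i)) l.
    move=> lt; rewrite (List.nth_indep _ _ (gap_box (fun i => f (c, i)) 0)).
      by rewrite List.map_nth List.seq_nth //; apply/ltP.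
    by rewrite List.length_map List.length_seq; apply/ltP.
  rewrite !nthE //; case: (ltngtP i j) => // h; first exact: gap_box_disjoint.
  move=> bm; apply: (@gap_box_disjoint (fun i => f (c, i)) _ j i h it) => //.
  by move=> i'; have [] := bm i'.
- by move=> u v /eqP uv; exact: meet_graphP.
Qed.

(** Adjacency of free vertex b to the m markers of axis i reveals the parities that determine the
    set chosen at (b, i). *)
Lemma meet_graph_inj : {in endpoint_choices &, injective (fun f => meet_graph (boxes_of f))}.
Proof.
move=> f g /endpoint_choicesP cf /endpoint_choicesP cg eqfg.
apply/ffunP=> -[b i]; apply: rank_parity_inj; first by rewrite cf cg.
move=> x xm.
(* Marker x of axis i has index i * m + x, which [boxes_of] decodes by division with remainder. *)
have lt_a : i * m + x < d * m.
  apply: (@leq_trans (i.+1 * m)); last by rewrite leq_mul2r ltn_ord orbT.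
  by rewrite mulSnr ltn_add2l.
pose u := lshift k (Ordinal lt_a); pose v := rshift (d * m) b.
have uv : u != v by rewrite -(inj_eq val_inj) /= neq_ltn ltn_addr.
have adjE (h : {ffun 'I_k * 'I_d -> {set 'I_m.+1}}) : (forall p, #|h p| = t.*2) ->
    (u, v) \in meet_graph (boxes_of h) <-> odd (rank (ends (h (b, i))) x).
  move=> ch; rewrite meet_graphP // /boxes_of (unsplitK (inl _)) (unsplitK (inr _)) /=.
  rewrite divnMDl; last exact: leq_ltn_trans xm.
  rewrite ?divn_small ?addn0 ?modnMDl ?modn_small //.
  exact: (marker_touchP (fun i => ch (b, i))).
have eqE : (u, v) \in meet_graph (boxes_of f) <-> (u, v) \in meet_graph (boxes_of g).
  by rewrite eqfg.
apply/idP/idP => [/(adjE f cf)/eqE/(adjE g cg) //|/(adjE g cg)/eqE/(adjE f cf) //].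
Qed.

Lemma bin_leq_card_G :
  expn 'C(m.+1, t.*2) (k * d) <= card_G (d * m + k) t d * (d * m + k)`!.
Proof.
rewrite -card_endpoint_choices -(card_in_imset meet_graph_inj).
apply: leq_card_G => _ /imsetP[f Hf ->]; split; first exact: meet_graph_simple.
exact: meet_graph_representable.
Qed.

End Construction.

(** * Falling factorials and casts to the reals *)

Lemma leq_exp_ffact n k : expn (n.+1 - k) k <= n ^_ k.
Proof.
elim: k n => [|k IH] [|n] //; first by rewrite subSS sub0n exp0n.
by rewrite subSS ffactSS expnS leq_mul ?leq_subr.
Qed.

Lemma ffact_leq_exp n k : n ^_ k <= expn n k.
Proof.
elim: k n => [|k IH] [|n] //; rewrite ffactSS expnS leq_mul2l.
by rewrite (leq_trans (IH n)) ?orbT //; case: k {IH} => // k; rewrite leq_exp2r.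
Qed.

Lemma INR_muln a b : INR (a * b) = (INR a * INR b)%R.
Proof. by rewrite -mult_INR. Qed.

Lemma INR_addn a b : INR (a + b) = (INR a + INR b)%R.
Proof. by rewrite -plus_INR. Qed.

Lemma INR_expn a b : INR (expn a b) = (INR a ^ b)%R.
Proof. by elim: b => // b IH; rewrite expnS INR_muln IH. Qed.

Local Open Scope R_scope.

(** * Logarithm estimates and Stirling's upper bound *)

Lemma ln_le_sub1 x : 0 < x -> ln x <= x - 1.
Proof. move=> x0; have := exp_ineq1_le (ln x); rewrite exp_ln //; lra. Qed.

(** The upper bound, from the Taylor polynomial of degree 6 of exp, is sharp enough to give 2 sqrt 2
    ln 2 < 2. *)
Lemma ln2_bounds : 1/2 < ln 2 <= 695/1000.
Proof.
split; first by have := ln_lt_2; lra.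
rewrite -[X in _ <= X]ln_exp; apply: Rcomplements.ln_le; first lra.
apply: Rle_trans (exp_ge_taylor _ 6 _); last lra.
simpl; lra.
Qed.

(** Midpoint rule for the convex function 1/y on [x, x+1]. The auxiliary [g] vanishes suitably at y
    = x, where it equals ln x, and has a nonnegative derivative. *)
Lemma ln_midpoint x : 0 < x -> ln x + 2 / (2 * x + 1) <= ln (x + 1).
Proof.
move=> x0; pose g y := ln y - 2 * (y - x) / (y + x).
have dg c : x <= c <= x + 1 -> derivable_pt_lim g c ((c - x) ^ 2 / (c * (c + x) ^ 2)).
  move=> Hc; apply/is_derive_Reals; rewrite /g; auto_derive; first by lra.
  field; lra.
have [|c [gc Hc]] := MVT_cor2 _ _ x (x + 1) _ dg; first lra.
have : 0 <= (c - x) ^ 2 / (c * (c + x) ^ 2).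
  apply: Rmult_le_pos; first exact: pow2_ge_0.
  apply/Rlt_le/Rinv_0_lt_compat/Rmult_lt_0_compat; first lra.
  by apply: pow_lt; lra.
have -> : 2 / (2 * x + 1) = 2 * (x + 1 - x) / (x + 1 + x) by field; lra.
have z : 2 * (x - x) / (x + x) = 0 by field; lra.
by move: gc; rewrite /g z; lra.
Qed.

(** The induction step amounts to (x + 1/2) (ln (x+1) - ln x) >= 1, which is [ln_midpoint]. *)
Lemma ln_fact_le k : 1 <= INR k ->
  ln (INR k`!) <= INR k * ln (INR k) - INR k + ln (INR k) / 2 + 1.
Proof.
elim: k => [|[|k] IH _]; [rewrite /=; lra | rewrite /= ln_1; lra |].
rewrite factS INR_muln; have k0 : 0 < INR k.+1 by apply: lt_0_INR; apply/ltP.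
rewrite ln_mult; last 2 first.
- by apply: lt_0_INR; apply/ltP.
- by apply: lt_0_INR; apply/ltP; exact: fact_gt0.
have k1 : 1 <= INR k.+1 by rewrite S_INR; have := pos_INR k; lra.
move: (IH k1) (ln_midpoint k0); rewrite [INR k.+2]S_INR.
set x := INR k.+1 in k0 *; set F := ln (INR _).
move=> HF Hm; have : (2 * x + 1) * (2 / (2 * x + 1)) = 2 by field; lra.
nra.
Qed.

(* F stands for ln (2t)!, bounded by Stirling. The case d = 1 is tight: it needs
   the e^(-2t) of Stirling's formula and 2 sqrt 2 ln 2 < 2. *)
Lemma fact_double_budget (t d : nat) F :
  1 <= INR t -> 1 <= INR d ->
  F <= 2 * INR t * ln (2 * INR t) - 2 * INR t + ln (2 * INR t) / 2 + 1 ->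
  INR d * F <= INR d * INR t * (2 * ln (INR t) + 2 * ln (INR d)
                 + 2 * ln 2 - 2 * sqrt 2 * ln 2 - 2 / 999) + 2 * ln 2 + 1.
Proof.
move=> T1 D1.
have [l0 l1] := ln2_bounds.
have s2 : sqrt 2 <= 14143 / 10000.
  rewrite -(sqrt_Rsqr (14143 / 10000)); last lra.
  by apply: sqrt_le_1_alt; rewrite /Rsqr; lra.
have s0 : 0 <= sqrt 2 by exact: sqrt_pos.
have sl : 2 * sqrt 2 * ln 2 <= 1966 / 1000 by nra.
have sl' : 2 * sqrt 2 * ln 2 <= 28286 / 10000 * ln 2 by nra.
rewrite ln_mult; [|lra|lra].
set l := ln 2 in l0 l1 sl sl' *; set T := INR t in T1 *; set lt := ln T.
set S := 2 * sqrt 2 * l in sl sl' *.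
case: d D1 => [|[|d]] D1; first by move: D1 => /=; lra.
  rewrite /= ln_1.
  (* Tangent to ln at 16: half its slope, 1/32, stays below the available slack 2 - 2 sqrt 2 ln 2 -
     2/999, which is at least 0.0319. *)
  have : lt <= 4 * l + T / 16 - 1.
    have -> : lt = 4 * l + ln (T / 16).
      have -> : 4 * l = ln (2 ^ 4) by rewrite ln_pow /=; [rewrite /l|]; lra.
      rewrite /lt -ln_mult; [|lra|lra]; congr ln; field.
    by have := @ln_le_sub1 (T / 16); lra.
  nra.
have D2 : 2 <= INR d.+2 by apply/(INR_leP 2 d.+2).
have : l <= ln (INR d.+2) by apply: Rcomplements.ln_le; lra.
have : lt <= T - 1 by apply: ln_le_sub1; lra.
set D := INR d.+2 in D1 D2 *; set lD := ln D.
move=> Hlt HlD HF.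
have TlD := Rmult_le_compat_l T l lD ltac:(lra) HlD.
(* For d >= 2 the term 2 ln d adds at least 2 ln 2 to the slack per t. This absorbs ln (2t) / 2 + 1
   before multiplying by d, so the additive 2 ln 2 + 1 is kept whole. *)
have Tl := Rmult_le_compat_l T (S - 2 * l) (576 / 1000) ltac:(lra) ltac:(lra).
have HF' : F <= T * (2 * lt + 2 * lD + 2 * l - S - 2 / 999) by nra.
have := Rmult_le_compat_l D _ _ ltac:(lra) HF'; lra.
Qed.

(* dm is the number of markers, B = ln 'C(m+1, 2t), F = ln (2t)!, NF = ln n!,
   K = ln |G|, lnL = ln (log2 n), s = sqrt 2. *)
Lemma count_budget n dm l t d lnn lnd lnt lnL s B F NF K :
  0 <= t -> 0 <= d -> 0 <= n -> 1 <= lnn ->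
  (n - dm) * d * B - NF <= K ->
  0 <= dm -> dm * lnn <= s * n * l ->
  B <= 2 * t * lnn ->
  2 * t * (l / 2 + lnn - lnd - lnL - 1 / 999) - F <= B ->
  NF <= n * lnn - n + lnn / 2 + 1 ->
  d * F <= d * t * (2 * lnt + 2 * lnd + 2 * l - 2 * s * l - 2 / 999) + 2 * l + 1 ->
  (2 * d * t - 1) * n * lnn
    - (4 * n * lnd + 2 * n * lnt + 2 * n * lnL + n * l) * (d * t)
    - 2 * n * l - 2 * lnn <= K.
Proof.
move=> t0 d0 n0 lnn1 HK dm0 Hdm HB1 HB2 HN HF.
(* The markers cost at most 2 s n l d t, exactly what the term -2 s l in [HF] pays for. In the final
   sum the 1/999 terms cancel too, and the 1 in [HF], times n, is offset by the -n of Stirling for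
   n!. *)
have h1 : dm * d * B <= 2 * (d * t) * (s * n * l).
  apply: (Rle_trans _ (dm * d * (2 * t * lnn))).
    by apply: Rmult_le_compat_l => //; exact: Rmult_le_pos.
  have := Rmult_le_compat_l _ _ _ (Rmult_le_pos _ _ d0 t0) Hdm; lra.
have h2 := Rmult_le_compat_l _ _ _ (Rmult_le_pos _ _ n0 d0) HB2.
have h3 := Rmult_le_compat_l _ _ _ n0 HF.
lra.
Qed.

(** * The counting inequality in logarithmic form and the choice of m *)

Lemma ln_bin_ge M t y : 0 < y -> y <= INR (M.+1 - t.*2) ->
  2 * INR t * ln y - ln (INR (t.*2)`!) <= ln (INR 'C(M, t.*2)).
Proof.
move=> y0 yM.
have F0 : 0 < INR (t.*2)`! by apply: lt_0_INR; apply/ltP; exact: fact_gt0.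
have p0 : 0 < y ^ t.*2 by exact: pow_lt.
have h : y ^ t.*2 <= INR 'C(M, t.*2) * INR (t.*2)`!.
  rewrite -INR_muln bin_ffact.
  apply: Rle_trans (_ : INR (expn (M.+1 - t.*2) t.*2) <= _).
    by rewrite INR_expn; apply: pow_incr; lra.
  by apply/INR_leP; exact: leq_exp_ffact.
have C0 : 0 < INR 'C(M, t.*2) by apply: (Rmult_lt_reg_r _ _ _ F0); lra.
have := Rcomplements.ln_le _ _ p0 h; rewrite ln_mult // ln_pow //.
by rewrite -addnn INR_addn; lra.
Qed.

Lemma ln_bin_le M j x : (M <= x)%coq_nat -> 0 < INR x -> 0 < INR 'C(M, j) ->
  ln (INR 'C(M, j)) <= INR j * ln (INR x).
Proof.
move=> /leP Mx x0 C0.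
have h : INR 'C(M, j) <= INR x ^ j.
  rewrite -INR_expn; apply/INR_leP.
  apply: (@leq_trans (M ^_ j)); last first.
    by apply: leq_trans (ffact_leq_exp M j) _; case: j {C0} => // j; rewrite leq_exp2r.
  by rewrite -bin_ffact leq_pmulr ?fact_gt0.
by rewrite -ln_pow //; exact: Rcomplements.ln_le.
Qed.

Lemma ln_card_G_ge n t d m :
  (0 < t)%coq_nat -> (0 < d)%coq_nat -> (muln d m <= n)%coq_nat ->
  0 < INR 'C(m.+1, t.*2) ->
  (INR n - INR d * INR m) * INR d * ln (INR 'C(m.+1, t.*2)) - ln (INR n`!)
    <= ln (INR (card_G n t d)).
Proof.
move=> /ltP t0 /ltP d0 /leP dmn C0.
have := bin_leq_card_G m (n - muln d m) d0 t0; rewrite subnKC // => /INR_leP.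
rewrite INR_expn INR_muln => h.
have F0 : 0 < INR n`! by apply: lt_0_INR; apply/ltP; exact: fact_gt0.
have p0 := pow_lt _ (muln (n - muln d m) d) C0.
have G0 : 0 < INR (card_G n t d) by apply: (Rmult_lt_reg_r _ _ _ F0); lra.
have := Rcomplements.ln_le _ _ p0 h; rewrite ln_mult // ln_pow // INR_muln.
have -> : INR (n - muln d m) = INR n - INR d * INR m.
  by rewrite -INR_muln -{2}(subnKC dmn) INR_addn; ring.
lra.
Qed.

(** A form with explicit constants: n >= 4 gives log2 n >= 2, and 1/2000 makes 2t at most a
    thousandth of the number of markers aimed at per axis. *)
Lemma card_G_lower_bound (n t d : nat) :
  (0 < t)%coq_nat -> (0 < d)%coq_nat -> (4 <= n)%coq_nat ->
  INR t * INR d * log2 (INR n) <= INR n / 2000 ->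
  (2 * INR d * INR t - 1) * INR n * log2 (INR n)
        - (4 * INR n * log2 (INR d) + 2 * INR n * log2 (INR t)
           + 2 * INR n * log2 (log2 (INR n)) + INR n) * (INR d * INR t)
        - 2 * INR n - 2 * log2 (INR n) <= log2 (INR (card_G n t d)).
Proof.
move=> t0 d0 n4 small.
have T1 : 1 <= INR t by apply: (le_INR 1).
have D1 : 1 <= INR d by apply: (le_INR 1).
have X4 : 4 <= INR n by have := le_INR _ _ n4; rewrite /=; lra.
have [l0 l1] := ln2_bounds.
have lnn2 : 2 * ln 2 <= ln (INR n).
  have -> : 2 * ln 2 = ln 4 by have -> : 4 = 2 * 2 by [ring]; rewrite ln_mult; lra.
  by apply: Rcomplements.ln_le; lra.
have s2 : sqrt 2 * sqrt 2 = 2 by apply: sqrt_sqrt; lra.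
have s0 : 0 <= sqrt 2 by exact: sqrt_pos.
have s1 : 1 <= sqrt 2 <= 2 by nra.
have lE : log2 (INR n) * ln 2 = ln (INR n) by rewrite /log2; field; lra.
set L := log2 (INR n) in small lE *.
have L2 : 2 <= L by apply: (Rmult_le_reg_r (ln 2)); lra.
have DL : 2 <= INR d * L by nra.
(* The marker loss 2 d^2 t m ln n and the gain 2 d t n ln m balance at m = n / (d ln n), that is,
   with 1 / ln 2 = 1.44... in place of sqrt 2. The nearby sqrt 2 adds exactly ln 2 / 2 to ln z. *)
pose z := sqrt 2 * INR n / (INR d * L).
have zE : z * (INR d * L) = sqrt 2 * INR n by rewrite /z; field; lra.
have z0 : 0 < z by apply: Rdiv_lt_0_compat; nra.
have [m [mz zm]] := nfloor_ex z (Rlt_le _ _ z0).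
have zn : 2 * z <= sqrt 2 * INR n by rewrite -zE; nra.
have tz : 2 * INR t <= z / 1000.
  apply: (Rmult_le_reg_r (INR d * L)); first lra.
  have -> : z / 1000 * (INR d * L) = sqrt 2 * INR n / 1000 by rewrite -zE; field.
  nra.
have mn : (m.+1 <= n)%coq_nat.
  by apply: INR_lt; nra.
have DmL : INR d * INR m * L <= sqrt 2 * INR n.
  by rewrite -zE; nra.
have dmn : (muln d m <= n)%coq_nat.
  by apply: INR_le; rewrite INR_muln; have := pos_INR m; nra.
have y0 : 0 < z * (999 / 1000) by lra.
(* From z < m + 1 and 2t <= z / 1000: every factor of the falling factorial is at least 0.999 z. *)
have yM : z * (999 / 1000) <= INR (m.+2 - t.*2).
  have := pos_INR (m.+2 - t.*2).
  have : INR m.+2 <= INR (m.+2 - t.*2) + 2 * INR t.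
    have -> : 2 * INR t = INR t.*2 by rewrite -addnn INR_addn; ring.
    by rewrite -INR_addn; apply/INR_leP; rewrite addnC -leq_subLR.
  by rewrite !S_INR; lra.
have T2 : INR t.*2 = 2 * INR t by rewrite -addnn INR_addn; ring.
have C0 : 0 < INR 'C(m.+1, t.*2).
  apply: lt_0_INR; apply/ltP; rewrite bin_gt0.
  by apply/INR_leP; rewrite T2 S_INR; lra.
have Bge := ln_bin_ge y0 yM.
have Ble := ln_bin_le mn ltac:(lra) C0; rewrite T2 in Ble.
have HK := ln_card_G_ge t0 d0 dmn C0.
have lny : ln (z * (999 / 1000)) >=
    ln 2 / 2 + ln (INR n) - ln (INR d) - ln L - 1 / 999.
  (* The loss of the factor 0.999 is ln (1000/999) <= 1/999. *)
  have e1 : ln (999 / 1000) = - ln (1000 / 999).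
    by rewrite -ln_Rinv; [congr ln; field | lra].
  have e2 := @ln_le_sub1 (1000 / 999) ltac:(lra).
  have e3 : 2 * ln (sqrt 2) = ln 2 by rewrite -[in RHS]s2 ln_mult; lra.
  rewrite ln_mult; [|lra|lra]; rewrite /z ln_div; [|nra|lra].
  by rewrite (ln_mult (sqrt 2)) ?(ln_mult (INR d)); lra.
have St := @ln_fact_le t.*2 ltac:(rewrite T2; lra); rewrite T2 in St.
have Sn := @ln_fact_le n ltac:(lra).
have bud := fact_double_budget T1 D1 St.
have main := @count_budget (INR n) (INR d * INR m) (ln 2) (INR t) (INR d)
  (ln (INR n)) (ln (INR d)) (ln (INR t)) (ln L) (sqrt 2) (ln (INR 'C(m.+1, t.*2)))
  (ln (INR (t.*2)`!)) (ln (INR n`!)) (ln (INR (card_G n t d))).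
have m0 := pos_INR m.
apply: (Rmult_le_reg_r (ln 2)); first lra.
rewrite -[X in _ <= X]/(ln (INR (card_G n t d)) / ln 2 * ln 2).
have -> : ln (INR (card_G n t d)) / ln 2 * ln 2 = ln (INR (card_G n t d)) by field; lra.
apply: Rle_trans (main _ _ _ _ HK _ _ _ _ Sn bud); try lra.
- apply: Req_le; rewrite -lE /log2; field; lra.
- nra.
- by rewrite -lE; nra.
- by nra.
Qed.

(* The asymptotic statement *)
Local Close Scope R_scope.

Theorem theorem1 (t d : nat -> nat)
  (ht : forall n, (1 <= t n)%N) (hd : forall n, (1 <= d n)%N)
  (hsmall : Un_cv (fun n => (INR (t n * d n ^ 2) / (INR n / log2 (INR n)))%R) 0%R) :
  exists C : R, exists N : nat, forall n : nat, (N <= n)%N ->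
    (log2 (INR (card_G n (t n) (d n)))
     >= (2 * INR (d n) * INR (t n) - 1) * INR n * log2 (INR n)
        - (4 * INR n * log2 (INR (d n)) + 2 * INR n * log2 (INR (t n))
           + 2 * INR n * log2 (log2 (INR n)) + INR n) * (INR (d n) * INR (t n))
        - 2 * INR n - C * log2 (INR n))%R.
Proof.
have [N HN] := hsmall (/ 2000)%R ltac:(lra).
exists 2%R, (maxn 4 N) => n; rewrite geq_max => /andP[n4 Nn].
apply: Rle_ge; apply: card_G_lower_bound; [exact/ltP | exact/ltP | exact/leP |].
have X4 : (4 <= INR n)%R by have := le_INR _ _ (leP n4); rewrite /=; lra.
have L0 : (0 < log2 (INR n))%R.
  have := ln2_bounds; have := Rcomplements.ln_le 2 (INR n).
  by move=> h1 h2; apply: Rdiv_lt_0_compat; [have := h1 _ _|]; lra.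
have := HN n (leP Nn); rewrite /R_dist => /Rabs_def2[h _].
(* Since d >= 1, smallness of t d^2 passes to t d, the quantity in [card_G_lower_bound]. *)
have td : (INR (t n) * INR (d n) <= INR (t n * d n ^ 2))%R.
  rewrite -INR_muln; apply/INR_leP; rewrite leq_mul2l.
  rewrite -[Nat.pow _ _]/(muln (d n) (muln (d n) 1)) muln1.
  by rewrite leq_pmulr ?orbT.
have h' : (INR (t n * d n ^ 2) * log2 (INR n) <= INR n / 2000)%R.
  move: h; set q := INR (t n * d n ^ 2); set L := log2 _ in L0 * => h.
  have e : (q * L = q / (INR n / L) * INR n)%R by field; lra.
  by rewrite e; nra.
by apply: Rle_trans h'; apply: Rmult_le_compat_r; lra.
Qed.
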